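(* Let $G$ be the Gram matrix of a complex equiangular $(6,3)$-frame. Then there is a complex number $a$ with $|a|=1$ such that $G$ is equivalent to \[G_6^{(1)}(a)=\frac{1}{\sqrt5}\left[ \begin{array}{cccc|cc} \sqrt{5} & 1 & 1 & 1 & 1 & 1 \\ 1 & \sqrt{5} & a & -a & -1 & 1 \\ 1 & \overline{a} & \sqrt{5} & 1 & -\overline{a} & -1 \\ 1 & -\overline{a} & 1 & \sqrt{5} & \overline{a} & -1 \\ \hline 1 & -1 & -a & a & \sqrt{5} & 1 \\ 1 & 1 & -1 & -1 & 1 & \sqrt{5} \end{array} \right].\]
   Context: For integers $n\ge m\ge 1$ (with $n\geq 2$), a complex equiangular tight frame, or complex equiangular $(n,m)$-frame, is a collection of $n$ unit vectors $\varphi_1,\dots,\varphi_n\in\mathbb{C}^m$ such that $|\langle\varphi_i,\varphi_j\rangle|=\alpha_{n,m}:=\sqrt{\frac{n-m}{m(n-1)}}$ for all $1\le i<j\le n$, and which is tight: the $m\times n$ matrix $F$ with columns $\varphi_1,\dots,\varphi_n$ has pairwise orthogonal rows of equal norm, i.e. $FF^\ast=\frac{n}{m}I_m$. Its Gram matrix is $G:=F^\ast F$; it is self-adjoint with unit diagonal, off-diagonal entries of modulus $\alpha_{n,m}$, and satisfies $mG^2=nG$. Two Gram matrices $G,G'$ of the same order are called equivalent if $G'=PDGD^\ast P^T$ for some permutation matrix $P$ and some unitary diagonal matrix $D$. *)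

(* Defs.v *)
From mathcomp Require Import all_boot all_order all_fingroup all_algebra.
From mathcomp Require Import reals complex.

Set Implicit Arguments.
Unset Strict Implicit.
Unset Printing Implicit Defensive.

Import Order.TTheory GRing.Theory Num.Theory.
Local Open Scope ring_scope.
Local Open Scope sesquilinear_scope.

Section EquiangularTightFrames.
Variable C : numClosedFieldType.

(* Linear in the second argument, so that the Gram matrix F^* F has entries
   G i j = <phi_i, phi_j>. *)
Definition cdot m (u v : 'cV[C]_m) : C := (u^t* *m v) 0 0.

Definition cnorm m (u : 'cV[C]_m) : C := sqrtC (cdot u u).

Definition welch (n m : nat) : C :=
  sqrtC ((n%:R - m%:R) / (m%:R * (n%:R - 1))).

Definition frame_mx n m (phi : 'I_n -> 'cV[C]_m) : 'M[C]_(m, n) :=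
  \matrix_(i < m, j < n) phi j i 0.

Definition equiangular_frame n m (phi : 'I_n -> 'cV[C]_m) : Prop :=
  [/\ (1 <= m <= n)%N /\ (2 <= n)%N,
      forall i, cnorm (phi i) = 1,
      forall i j : 'I_n, (i < j)%N -> `|cdot (phi i) (phi j)| = welch n m
    & frame_mx phi *m (frame_mx phi)^t* = (n%:R / m%:R)%:M].

Definition frame_gram n m (phi : 'I_n -> 'cV[C]_m) : 'M[C]_n :=
  (frame_mx phi)^t* *m frame_mx phi.

Definition is_frame_gram n m (G : 'M[C]_n) : Prop :=
  exists2 phi : 'I_n -> 'cV[C]_m, equiangular_frame phi & G = frame_gram phi.

Definition gram_equiv n (G G' : 'M[C]_n) : Prop :=
  exists (s : 'S_n) (D : 'M[C]_n),
    [/\ is_diag_mx D, D \is unitarymx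
      & G' = perm_mx s *m D *m G *m D^t* *m (perm_mx s)^T].

Definition rows_mx n (rows : seq (seq C)) : 'M[C]_n :=
  \matrix_(i < n, j < n) nth 0 (nth [::] rows i) j.

Definition G61 (a : C) : 'M[C]_6 :=
  let r := sqrtC 5 in
  r^-1 *: rows_mx 6
    [:: [:: r;     1;     1;     1;     1;     1];
        [:: 1;     r;     a;   - a;   - 1;     1];
        [:: 1;  a^*;    r;     1; - a^*; - 1];
        [:: 1; - a^*;   1;     r;  a^*;  - 1];
        [:: 1;   - 1;   - a;     a;     r;     1];
        [:: 1;     1;   - 1;   - 1;     1;     r]].

End EquiangularTightFrames.

(* Main.v *)
Require Import Defs.
From mathcomp Require Import all_boot all_order all_fingroup all_algebra.
From mathcomp Require Import reals complex.
From mathcomp Require Import ring.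
Import Order.TTheory GRing.Theory Num.Theory.
Local Open Scope ring_scope.

(** Off its diagonal, the Gram matrix of an equiangular (6,3)-frame is 1/sqrt 5
    times a Hermitian matrix S with unimodular entries, and G^2 = 2 G says that
    distinct rows of S are orthogonal: S is a complex conference matrix of
    order 6.  Conjugating by a unitary diagonal matrix makes the row and the
    column of one index o equal to 1.  Let T be the remaining 5 x 5 block.

    Orthogonality of row o to row a says that the four off-diagonal entries of
    row a of T sum to 0; four unimodular numbers with sum 0 form two pairs
    (x, -x), (y, -y) [row_split_cases].  So each row of T gives a perfect
    matching of the four other indices.  Orthogonality of rows a and b of T
    says that three unimodular numbers sum to -1.

    Call a row balanced if it reads x, x, -x, -x.  If some pair of indices
    carries opposite entries in two different rows, then the fifth row is
    balanced [opposite_twice_balanced].  If no pair does so, the five matchings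
    are forced up to relabelling, and following opposite entries through
    symmetric positions runs around pentagons; being odd, these force all
    entries of a row to square to -1, so that row is balanced after all
    [pentagon, balanced_of_two_splits, exists_balanced_row].

    Finally, a balanced row must have x = 1 or x = -1, and its presence
    determines T up to one unimodular parameter [balanced_row_sign,
    conference6_shape].  The result is G_6^(1)(a) up to the order of the
    indices.

    Conjugation acts on unimodular numbers as inversion, so everything about S
    holds over any field of characteristic other than 2, with S b a the
    inverse of S a b. *)

(** * Reciprocal conference matrices of order 6 *)

Section Conference.
Variables (F : fieldType) (V : eqType).
Implicit Types (S : V -> V -> F) (o a b c d e f : V).

(** Complex conference matrices of order 6, with conjugation of unimodular
    entries replaced by inversion.  Only off-diagonal entries are
    constrained, so that a rescaled Gram matrix qualifies as it stands. *)
Definition conference6 S : Prop :=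
  (forall a b, a != b -> S a b * S b a = 1) /\
  (forall a b c d e f, uniq [:: a; b; c; d; e; f] ->
     S a c * S c b + S a d * S d b + S a e * S e b + S a f * S f b = 0).

Lemma conference6_neq0 S a b : conference6 S -> a != b -> S a b != 0.
Proof.
move=> [Sinv _] ab; apply/eqP => Sab0; have /eqP := Sinv a b ab.
by rewrite Sab0 mul0r eq_sym oner_eq0.
Qed.

Definition gauge_weight S o x : F := if x == o then 1 else S o x.

(** Conjugation of S by the diagonal matrix of weights that turns row o and
    column o into ones. *)
Definition gauge S o a b : F :=
  gauge_weight S o a * S a b / gauge_weight S o b.

Lemma gauge_conference6 S o : conference6 S -> conference6 (gauge S o).
Proof.
move=> Sconf; have [Sinv Sorth] := Sconf.
pose w := gauge_weight S o.
have w0 x : w x != 0.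
  rewrite /w /gauge_weight; case: (eqVneq x o) => [_|xo].
    by rewrite oner_eq0.
  by apply: conference6_neq0 Sconf _; rewrite eq_sym.
have gaugeE a b : gauge S o a b = w a * S a b / w b by [].
split=> [a b ab|a b c d e f U]; rewrite !gaugeE.
  by rewrite -[RHS](Sinv a b ab); field; rewrite !w0.
transitivity (w a / w b * (S a c * S c b + S a d * S d b
                           + S a e * S e b + S a f * S f b)).
  by field; rewrite !w0.
by rewrite Sorth ?mulr0.
Qed.

Lemma gauge_base S o a : conference6 S -> a != o -> gauge S o o a = 1.
Proof.
move=> Sconf ao; rewrite /gauge /gauge_weight eqxx (negbTE ao) mul1r divff //.
by apply: conference6_neq0 Sconf _; rewrite eq_sym.
Qed.

End Conference.

(** Relabelled index lists are recognised as permutations by counting: the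
    required equality between sums of booleans is a ring identity. *)
Lemma uniq_shuffle (T : eqType) (s1 s2 : seq T) :
  uniq s1 -> (forall p : pred T, count p s2 = count p s1) -> uniq s2.
Proof. by move=> U E; rewrite (perm_uniq (s2 := s1)) //; apply/seq.permP. Qed.

Ltac reorder U := apply: (uniq_shuffle _ _ _ U) => p /=; ring.

(** * Opposite entries and balanced rows *)

Section Core.
Variables (F : fieldType) (V : eqType) (S : V -> V -> F) (o : V).
Hypotheses (F2 : 2 != 0 :> F) (Sconf : conference6 F V S)
  (So : forall a, a != o -> S o a = 1).
Implicit Types a b c d e : V.

Let Sinv := Sconf.1.
Let Sorth := Sconf.2.

Lemma neq_base a b c d e : uniq [:: o; a; b; c; d; e] -> a != o.
Proof. by move=> /= /andP[]; rewrite !inE negb_or eq_sym => /andP[]. Qed.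

Lemma neq_pair a b c d e : uniq [:: o; a; b; c; d; e] -> a != b.
Proof. by move=> /= /and3P[_]; rewrite !inE negb_or => /andP[]. Qed.

Lemma So' a : a != o -> S a o = 1.
Proof. by move=> ao; have := Sinv a o ao; rewrite So // mulr1. Qed.

Let S_neq0 a b : a != b -> S a b != 0 := @conference6_neq0 F V S a b Sconf.

Lemma Sswap a b : a != b -> S b a = (S a b)^-1.
Proof.
move=> ab; apply: (mulfI (S_neq0 a b ab)).
by rewrite Sinv // divff // S_neq0.
Qed.

(** Orthogonality of rows a and o. *)
Lemma row_sum a b c d e : uniq [:: o; a; b; c; d; e] ->
  S a b + S a c + S a d + S a e = 0.
Proof.
move=> U; have U' : uniq [:: a; o; b; c; d; e] by reorder U.
rewrite -[RHS](Sorth _ _ _ _ _ _ U') !So' ?mulr1 //.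
- by apply: (neq_base e a b c d); reorder U.
- by apply: (neq_base d a b c e); reorder U.
- by apply: (neq_base c a b d e); reorder U.
- by apply: (neq_base b a c d e); reorder U.
Qed.

Lemma col_sum a b c d e : uniq [:: o; a; b; c; d; e] ->
  S b a + S c a + S d a + S e a = 0.
Proof.
move=> U; rewrite -[RHS](Sorth _ _ _ _ _ _ U) !So ?mul1r //.
- by apply: (neq_base e a b c d); reorder U.
- by apply: (neq_base d a b c e); reorder U.
- by apply: (neq_base c a b d e); reorder U.
- by apply: (neq_base b a c d e); reorder U.
Qed.

Lemma pair_sum a b c d e : uniq [:: o; a; b; c; d; e] ->
  S a c * S c b + S a d * S d b + S a e * S e b = -1.
Proof.
move=> U; have U' : uniq [:: a; b; o; c; d; e] by reorder U.
have := Sorth _ _ _ _ _ _ U'; rewrite (So' a) ?So.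
- by rewrite mulr1 -!addrA => /eqP; rewrite addrC addr_eq0 !addrA => /eqP.
- by apply: (neq_base b a c d e); reorder U.
- exact: neq_base U.
Qed.

(** The matching {b,c}, {d,e} read off row a. *)
Definition row_split a b c d e := S a b = - S a c /\ S a d = - S a e.

(** Reciprocity turns the column sum into the vanishing of the sum e3 of the
    triple products, while the row sum e1 vanishes too.  A quartic polynomial
    with e1 = e3 = 0 is even, so its roots come in opposite pairs; concretely
    (x + y)(x + z)(x + t) = x^2 e1 + e3. *)
Lemma row_split_cases a b c d e : uniq [:: o; a; b; c; d; e] ->
  [\/ row_split a b c d e, row_split a b d c e | row_split a b e c d].
Proof.
move=> U; have R := row_sum _ _ _ _ _ U; have C := col_sum _ _ _ _ _ U.
have ab : a != b := neq_pair _ _ _ _ _ U.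
have ac : a != c by apply: (neq_pair a c b d e); reorder U.
have ad : a != d by apply: (neq_pair a d b c e); reorder U.
have ae : a != e by apply: (neq_pair a e b c d); reorder U.
have e3 : S a c * S a d * S a e + S a b * S a d * S a e
        + S a b * S a c * S a e + S a b * S a c * S a d = 0.
  transitivity (S a b * S a c * S a d * S a e
                * (S b a + S c a + S d a + S e a)).
    by rewrite !(Sswap a) //; field; rewrite !S_neq0.
  by rewrite C mulr0.
have : (S a b + S a c) * ((S a b + S a d) * (S a b + S a e)) == 0.
  apply/eqP; transitivity (S a b ^+ 2 * (S a b + S a c + S a d + S a e)
    + (S a c * S a d * S a e + S a b * S a d * S a e
        + S a b * S a c * S a e + S a b * S a c * S a d)); first by ring.
  by rewrite R e3 mulr0 addr0.
have opp x y z t : x + y + z + t = 0 :> F -> x + y = 0 -> x = - y /\ z = - t.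
  move=> s xy; split; apply/eqP; rewrite -addr_eq0; apply/eqP => //.
  by rewrite -s xy add0r.
rewrite !mulf_eq0 => /or3P[] /eqP E.
- by apply: Or31; apply: opp.
- by apply: Or32; apply: opp => //; rewrite -R; ring.
- by apply: Or33; apply: opp => //; rewrite -R; ring.
Qed.

Definition balanced_row := exists a b c d e,
  [/\ uniq [:: o; a; b; c; d; e],
      S a b = S a c, S a d = - S a b & S a e = - S a b].

(** The rows c and d each contribute -1 to the inner product -1 of rows a and
    b, so the row e contributes 1, that is, S e a = S e b.  Since row e splits
    into opposite pairs, its other two entries are both - S e a. *)
Lemma opposite_twice_balanced a b c d e : uniq [:: o; a; b; c; d; e] ->
  S c a = - S c b -> S d a = - S d b -> balanced_row.
Proof.
move=> U Ec Ed.
have ae : a != e by apply: (neq_pair a e b c d); reorder U.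
have ac : a != c by apply: (neq_pair a c b d e); reorder U.
have ad : a != d by apply: (neq_pair a d b c e); reorder U.
have P : S e b = S e a.
  have := pair_sum _ _ _ _ _ U.
  rewrite -[S c b]opprK -Ec -[S d b]opprK -Ed !mulrN !Sinv // => E.
  have {}E : S a e * S e b = 1.
    by transitivity ((-1 - 1 + S a e * S e b) + 2); [ring | rewrite E; ring].
  by apply: (mulfI (S_neq0 _ _ ae)); rewrite E Sinv.
have Ue : uniq [:: o; e; a; b; c; d] by reorder U.
case: (row_split_cases _ _ _ _ _ Ue) => [[E _]|[E1 E2]|[E1 E2]].
- have ea : e != a by rewrite eq_sym.
  suff Sea0 : S e a = 0 by move: (S_neq0 _ _ ea); rewrite Sea0 eqxx.
  apply: (mulfI F2); rewrite mulr0.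
  by transitivity (S e a + S e b); [rewrite P; ring | rewrite {1}E; ring].
- by exists e, a, b, c, d; split=> //; [rewrite E1 opprK | rewrite -P E2 opprK].
- by exists e, a, b, c, d; split=> //; [rewrite -P E2 opprK | rewrite E1 opprK].
Qed.

(** With z = S a b, the entries S a b, S b c, S c d, S d e, S e a along the
    cycle are alternately z and - z^-1.  As the cycle is odd it closes up only
    if z = - z^-1. *)
Lemma pentagon a b c d e : uniq [:: o; a; b; c; d; e] ->
  S b a = - S b c -> S c b = - S c d -> S d c = - S d e -> S e d = - S e a ->
  S a e = - S a b -> S a b ^+ 2 = -1.
Proof.
move=> U Eb Ec Ed Ee Ea.
have ab : a != b by apply: (neq_pair a b c d e); reorder U.
have bc : b != c by apply: (neq_pair b c a d e); reorder U.
have cd : c != d by apply: (neq_pair c d a b e); reorder U.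
have de : d != e by apply: (neq_pair d e a b c); reorder U.
have ea : e != a by apply: (neq_pair e a b c d); reorder U.
have z0 := S_neq0 _ _ ab.
have Ebc : S b c = - (S a b)^-1 by rewrite -[LHS]opprK -Eb Sswap.
have Ecd : S c d = S a b.
  by rewrite -[LHS]opprK -Ec Sswap // Ebc invrN invrK opprK.
have Ede : S d e = - (S a b)^-1 by rewrite -[LHS]opprK -Ed Sswap // Ecd.
have Eea : S e a = S a b.
  by rewrite -[LHS]opprK -Ee Sswap // Ede invrN invrK opprK.
have := Ea; rewrite Sswap // Eea => E.
by rewrite expr2 -[X in X * _]opprK -E mulNr mulVf.
Qed.

(** The hypotheses are the matchings {b,c},{d,e} of row a and {a,d},{c,e} of
    row b.  Any matching of rows c, d, e other than {a,e},{b,d} and {a,c},{b,e}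
    and {a,b},{c,d} repeats a pair that an earlier row already has as opposite.
    In the remaining case the matchings follow the two pentagons a b d e c and
    a d c b e, hence S a b and S a d have the same square -1. *)
Lemma balanced_of_two_splits a b c d e : uniq [:: o; a; b; c; d; e] ->
  row_split a b c d e -> row_split b a d c e -> balanced_row.
Proof.
move=> U [a1 a2] [b1 b2].
have U3 : uniq [:: o; c; a; b; d; e] by reorder U.
have U4 : uniq [:: o; d; a; b; c; e] by reorder U.
have U5 : uniq [:: o; e; a; b; c; d] by reorder U.
case: (row_split_cases _ _ _ _ _ U3) => [[c1 c2]|[c1 c2]|[c1 c2]].
- by apply: (opposite_twice_balanced d e a c b) => //; reorder U.
- by apply: (opposite_twice_balanced a d b c e) => //; reorder U.
case: (row_split_cases _ _ _ _ _ U4) => [[d1 d2]|[d1 d2]|[d1 d2]].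
- by apply: (opposite_twice_balanced c e b d a) => //; reorder U.
- case: (row_split_cases _ _ _ _ _ U5) => [[e1 e2]|[e1 e2]|[e1 e2]].
  + have sym x y : x = - y -> y = - x :> F by move->; rewrite opprK.
    have ab : S a b ^+ 2 = -1.
      apply: (pentagon a b d e c); solve [reorder U | by [] | exact: sym].
    have ad : S a d ^+ 2 = -1.
      apply: (pentagon a d c b e); solve [reorder U | by [] | exact: sym].
    move/eqP: ad; rewrite -ab eqf_sqr => /orP[] /eqP ad.
      exists a, d, b, c, e; rewrite ad (sym _ _ a1) -ad (sym _ _ a2).
      by split=> //; reorder U.
    exists a, d, c, b, e; rewrite (sym _ _ a1) (sym _ _ a2) ad opprK.
    by split=> //; reorder U.
  + by apply: (opposite_twice_balanced a c d e b) => //; reorder U.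
  + by apply: (opposite_twice_balanced a d b e c) => //; reorder U.
- by apply: (opposite_twice_balanced b c a d e) => //; reorder U.
Qed.

(** Relabelling brings the matching of row a to {b,c},{d,e}.  If row b pairs a
    with c then {d,e} is opposite twice; pairing a with d or with e differs by
    exchanging d and e. *)
Lemma exists_balanced_row a b c d e :
  uniq [:: o; a; b; c; d; e] -> balanced_row.
Proof.
have split_case a' b' c' d' e' : uniq [:: o; a'; b'; c'; d'; e'] ->
    row_split a' b' c' d' e' -> balanced_row.
  move: a' b' c' d' e' => {}a {}b {}c {}d {}e U [a1 a2].
  have Ub : uniq [:: o; b; a; c; d; e] by reorder U.
  case: (row_split_cases _ _ _ _ _ Ub) => [[b1 b2]|[b1 b2]|[b1 b2]].
  - by apply: (opposite_twice_balanced d e a b c) => //; reorder U.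
  - exact: (balanced_of_two_splits a b c d e).
  - apply: (balanced_of_two_splits a b c e d); first by reorder U.
      by split; rewrite // a2 opprK.
    by split.
move=> U; case: (row_split_cases _ _ _ _ _ U); apply: split_case => //.
  by reorder U.
by reorder U.
Qed.

(** Let row e be balanced, with x = S e a and t = S a b.  The row sum of a and
    its inner product with row e both involve S a c + S a d; eliminating this
    sum leaves 2 t + x + x^-1 = 0.  The transposed relations give
    2 t^-1 + x + x^-1 = 0, so t^2 = 1, and then (x + t)^2 = 0.  With x = -t the row
    sum of a reduces to S a c + S a d = 0. *)
Lemma balanced_row_sign a b c d e : uniq [:: o; a; b; c; d; e] ->
  S e a = S e b -> S e c = - S e a -> S e d = - S e a ->
  [/\ S e a = 1 \/ S e a = -1, S a b = - S e a & S a d = - S a c].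
Proof.
move=> U E1 E2 E3.
have ab : a != b by apply: (neq_pair a b c d e); reorder U.
have ea : e != a by apply: (neq_pair e a b c d); reorder U.
have eb : e != b by apply: (neq_pair e b a c d); reorder U.
have ec : e != c by apply: (neq_pair e c a b d); reorder U.
have ed : e != d by apply: (neq_pair e d a b c); reorder U.
have Ua : uniq [:: o; a; e; b; c; d] by reorder U.
have Ue : uniq [:: o; e; a; b; c; d] by reorder U.
have R := row_sum _ _ _ _ _ Ua; have C := col_sum _ _ _ _ _ Ua.
have P := pair_sum _ _ _ _ _ Ua; have Q := pair_sum _ _ _ _ _ Ue.
have x0 := S_neq0 _ _ ea; have t0 := S_neq0 _ _ ab.
rewrite (Sswap e b) // (Sswap e c) // (Sswap e d) // E2 E3 -E1 in P.
rewrite E2 E3 -E1 (Sswap a b) // in Q.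
rewrite (Sswap e a) // in R; rewrite (Sswap a b) // in C.
set x := S e a in x0 P Q R C *; set t := S a b in t0 P Q R C *.
have P' : 2 * t + x + x^-1 = 0.
  transitivity (x * ((t * x^-1 + S a c * (- x)^-1 + S a d * (- x)^-1) + 1)
     + (x^-1 + t + S a c + S a d)); first by field; rewrite oppr_eq0 x0.
  by rewrite P R addNr mulr0 addr0.
have Q' : 2 * t^-1 + x + x^-1 = 0.
  transitivity (x^-1 * ((x / t + - x * S c a + - x * S d a) + 1)
     + (x + t^-1 + S c a + S d a)); first by field; rewrite x0 t0.
  by rewrite Q C addNr mulr0 addr0.
have tV : t = t^-1.
  apply: (mulfI F2); apply: (addIr (x + x^-1)); by rewrite !addrA P' Q'.
have /eqP : t ^+ 2 = 1 ^+ 2 by rewrite expr1n expr2 {2}tV divff.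
have xt : (x + t) ^+ 2 = 0.
  transitivity (x * (2 * t + x + x^-1) + (t * t - 1)); first by field.
  by rewrite P' {2}tV divff // subrr mulr0 addr0.
have {}xt : x = - t.
  by apply/eqP; rewrite -addr_eq0; move/eqP: xt; rewrite sqrf_eq0.
rewrite eqf_sqr xt opprK => Ht.
split=> //; first by case/orP: Ht => /eqP->; rewrite ?opprK; [right|left].
apply/eqP; rewrite -addr_eq0 addrC -R xt invrN -tV addNr add0r //.
Qed.

(** In the chosen labelling row e is 1, 1, -1, -1 on a, b, c, d; the only free
    entry is S a c. *)
Lemma conference6_shape a b c d e : uniq [:: o; a; b; c; d; e] ->
  exists a' b' c' d' e',
  [/\ uniq [:: o; a'; b'; c'; d'; e'],
      [/\ S e' a' = 1, S e' b' = 1, S e' c' = -1 & S e' d' = -1],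
      S a' b' = -1, S c' d' = 1
    & [/\ S a' d' = - S a' c', S b' c' = - S a' c' & S b' d' = S a' c']].
Proof.
move=> /exists_balanced_row {a b c d e} [e [a [b [c [d [U E1 E2 E3]]]]]].
(* If the first sign is -1, exchange {a,b} and {c,d}. *)
wlog x1 : a b c d U E1 E2 E3 / S e a = 1 => [wl|].
  have U' : uniq [:: o; a; b; c; d; e] by reorder U.
  have [[x1|x1] _ _] := balanced_row_sign _ _ _ _ _ U' E1 E2 E3.
    exact: (wl a b c d).
  apply: (wl c d a b).
  - by reorder U.
  - by rewrite E2 E3.
  - by rewrite E2 opprK.
  - by rewrite E2 opprK.
  - by rewrite E2 x1 opprK.
have U1 : uniq [:: o; a; b; c; d; e] by reorder U.
have U2 : uniq [:: o; b; a; c; d; e] by reorder U.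
have U3 : uniq [:: o; c; d; a; b; e] by reorder U.
have ac : a != c by apply: (neq_pair a c b d e); reorder U.
have bc : b != c by apply: (neq_pair b c a d e); reorder U.
have [_ ab ad] := balanced_row_sign _ _ _ _ _ U1 E1 E2 E3.
have [_ _ bd] := balanced_row_sign _ _ _ _ _ U2 (esym E1)
                   (etrans E2 (congr1 -%R E1)) (etrans E3 (congr1 -%R E1)).
have [|||_ cd cb] := balanced_row_sign _ _ _ _ _ U3.
- by rewrite E2 E3.
- by rewrite E2 opprK.
- by rewrite E2 opprK.
have bc' : S b c = - S a c.
  rewrite (Sswap c b) 1?eq_sym // cb invrN -Sswap // eq_sym //.
exists a, b, c, d, e; split=> //.
- by rewrite -E1 E2 E3 x1.
- by rewrite ab x1.
- by rewrite cd E2 x1 opprK.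
- by split; rewrite // bd bc' opprK.
Qed.

End Core.

(** * From frames to conference matrices *)

Lemma big_ord_uniq (U : nmodType) n (s : seq 'I_n) (f : 'I_n -> U) :
  uniq s -> size s = n -> \sum_(i < n) f i = \sum_(i <- s) f i.
Proof.
move=> us ss; rewrite [RHS]big_uniq //=; apply: eq_bigl => i.
have [||_ ->] := uniq_min_size us (s2 := enum 'I_n).
- by move=> j _; rewrite mem_enum.
- by rewrite ss size_enum_ord.
by rewrite mem_enum.
Qed.

Section Frames.
Local Open Scope sesquilinear_scope.
Variable C : numClosedFieldType.

Lemma frame_gramE n m (phi : 'I_n -> 'cV[C]_m) i j :
  frame_gram phi i j = cdot (phi i) (phi j).
Proof.
by rewrite /frame_gram /cdot !mxE; apply: eq_bigr => k _; rewrite !mxE.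
Qed.

Lemma cdot_conj m (u v : 'cV[C]_m) : cdot v u = (cdot u v)^*.
Proof.
rewrite /cdot !mxE rmorph_sum; apply: eq_bigr => k _.
by rewrite !mxE rmorphM /= conjCK mulrC.
Qed.

Lemma frame_gram_sqr n m (phi : 'I_n -> 'cV[C]_m) : equiangular_frame phi ->
  frame_gram phi *m frame_gram phi = (n%:R / m%:R) *: frame_gram phi.
Proof.
case=> _ _ _ tight; rewrite /frame_gram mulmxA -(mulmxA _ (frame_mx phi)) tight.
by rewrite mul_mx_scalar scalemxAl.
Qed.

Lemma frame_gram_diag n m (phi : 'I_n -> 'cV[C]_m) i : equiangular_frame phi ->
  frame_gram phi i i = 1.
Proof.
case=> _ /(_ i) unit_phi _ _; rewrite frame_gramE.
by rewrite -[LHS]sqrtCK -/(cnorm _) unit_phi expr1n.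
Qed.

Lemma frame_gram_norm n m (phi : 'I_n -> 'cV[C]_m) i j :
  equiangular_frame phi -> i != j -> `|frame_gram phi i j| = welch C n m.
Proof.
case=> _ _ angle _ ij; rewrite frame_gramE.
have [lt_ij|lt_ji|/val_inj eq_ij] := ltngtP i j; first exact: angle.
  by rewrite cdot_conj norm_conjC angle.
by rewrite eq_ij eqxx in ij.
Qed.

Lemma welch63 : welch C 6 3 = (sqrtC 5)^-1.
Proof.
rewrite -rootCV //; congr sqrtC.
have nz k : k.+1%:R != 0 :> C by rewrite pnatr_eq0.
by field; rewrite ?nz.
Qed.

Lemma sqrt5_neq0 : sqrtC 5 != 0 :> C.
Proof. by rewrite sqrtC_eq0 pnatr_eq0. Qed.

Variable phi : 'I_6 -> 'cV[C]_3.
Hypothesis phi_frame : equiangular_frame phi.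
Let G := frame_gram phi.

(** The diagonal of this rescaled Gram matrix is sqrt 5; its off-diagonal part
    is a complex conference matrix. *)
Definition signature i j := sqrtC 5 * G i j.

Lemma signature_conj i j : signature j i = (signature i j)^*.
Proof.
rewrite /signature rmorphM /= /G !frame_gramE (cdot_conj _ (phi i)).
congr (_ * _).
by rewrite geC0_conj // sqrtC_ge0 ler0n.
Qed.

Lemma signature_norm i j : i != j -> `|signature i j| = 1.
Proof.
move=> ij; rewrite normrM frame_gram_norm // welch63 ger0_norm.
  by rewrite mulfV ?sqrt5_neq0.
by rewrite sqrtC_ge0 ler0n.
Qed.

(** In entry (a, b) of G^2 = 2 G the two summands through the diagonal already
    give 2 G a b, so the other four summands cancel. *)
Lemma signature_conference6 : conference6 C _ signature.
Proof.
split=> [a b ab|a b c d e f U].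
  by rewrite (signature_conj a b) -normCK signature_norm ?expr1n.
have : (G *m G) a b = (6 / 3 *: G) a b by rewrite frame_gram_sqr.
rewrite [(G *m G) a b]mxE [(_ *: G) a b]mxE (big_ord_uniq _ _ _ _ U) //=.
rewrite !big_cons big_nil.
rewrite {1}/G {3}/G !frame_gram_diag // => E.
have {E}E : G a c * G c b + G a d * G d b + G a e * G e b + G a f * G f b = 0.
  transitivity (6 / 3 * G a b - 2 * G a b); last by field.
  by rewrite -E; ring.
transitivity (sqrtC 5 ^+ 2 *
  (G a c * G c b + G a d * G d b + G a e * G e b + G a f * G f b)).
  by rewrite /signature; ring.
by rewrite E mulr0.
Qed.

End Frames.

(** * Equivalence with the one-parameter family *)

Section Equivalence.
Local Open Scope sesquilinear_scope.
Variable C : numClosedFieldType.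

Lemma conj_inv (z : C) : `|z| = 1 -> z^* = z^-1.
Proof. by move=> z1; rewrite invC_norm z1 expr1n invr1 mul1r. Qed.

(** Equivalence by the permutation f and the unitary diagonal matrix of the
    w i; division by w j is multiplication by its conjugate. *)
Lemma gram_equiv_entrywise n (G G' : 'M[C]_n) (f : 'I_n -> 'I_n)
    (w : 'I_n -> C) : injective f -> (forall i, `|w i| = 1) ->
    (forall i j, G' i j = w (f i) * G (f i) (f j) / w (f j)) ->
  gram_equiv G G'.
Proof.
move=> f_inj w1 G'E; pose d : 'rV_n := \row_j w j.
have dconj : (diag_mx d)^t* = diag_mx (map_mx Num.conj d).
  by rewrite tr_diag_mx map_diag_mx.
exists (perm f_inj), (diag_mx d); split.
- exact: diag_mx_is_diag.
- apply/unitarymxP; rewrite dconj mulmx_diag -diag_const_mx; congr diag_mx.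
  by apply/rowP=> j; rewrite !mxE -normCK w1 expr1n.
apply/matrixP=> i j; rewrite tr_perm_mx -col_permE -!mulmxA -row_permE dconj.
by rewrite mul_diag_mx mul_mx_diag ![RHS]mxE !permE !mxE G'E conj_inv // mulrA.
Qed.

Lemma gram_equiv_G61 (phi : 'I_6 -> 'cV[C]_3) : equiangular_frame phi ->
  exists a : C, `|a| = 1 /\ gram_equiv (frame_gram phi) (G61 a).
Proof.
move=> phi_frame; pose S := signature C phi; pose o : 'I_6 := ord0.
have Sconf : conference6 C _ S := signature_conference6 C phi phi_frame.
have Nconf := gauge_conference6 _ _ S o Sconf.
have S1 i j : i != j -> `|S i j| = 1 by exact: signature_norm.
pose w := gauge_weight C _ S o; set N := gauge C _ S o in Nconf.
have w1 i : `|w i| = 1.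
  rewrite /w /gauge_weight; case: (eqVneq i o) => [_|io]; first exact: normr1.
  by rewrite S1 // eq_sym.
have NE i j : N i j = w i * S i j / w j by [].
have Nnorm i j : i != j -> `|N i j| = 1.
  by move=> ij; rewrite NE normrM normfV normrM !w1 S1 // invr1 !mulr1.
have Nconj i j : N j i = (N i j)^*.
  have Sconj : S j i = (S i j)^* by exact: signature_conj.
  by rewrite !NE fmorph_div rmorphM /= -Sconj !conj_inv // invrK; ring.
have No i : i != o -> N o i = 1 by exact: gauge_base.
have U : uniq [:: o; inord 1; inord 2; inord 3; inord 4; inord 5].
  by rewrite -(map_inj_uniq val_inj) /= !inordK.
have F2 : 2 != 0 :> C by rewrite pnatr_eq0.
have [a [b [c [d [e [{}U [ea eb ec ed] ab cd [ad bc bd]]]]]]] :=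
  conference6_shape C _ N o F2 Nconf No _ _ _ _ _ U.
pose z := N a c.
(* The order in which the rows of the target matrix list the labels: its second
   and fifth rows are a and b, its third and fourth rows are c and d. *)
pose v := [:: o; a; c; d; b; e].
have Uv : uniq v by reorder U.
pose f (i : 'I_6) := nth o v i.
have f_inj : injective f.
  move=> i j /eqP; rewrite /f nth_uniq // => /eqP; exact: val_inj.
have z1 : `|z| = 1.
  by apply: Nnorm; apply: (neq_pair _ o a c b d e); reorder U.
exists z; split=> //.
apply: (gram_equiv_entrywise _ _ _ f w) => // i j.
apply: (mulfI (sqrt5_neq0 C)).
have -> : sqrtC 5 * (w (f i) * frame_gram phi (f i) (f j) / w (f j))
    = if i == j then sqrtC 5 else N (f i) (f j).
  have w0 k : w k != 0 by rewrite -normr_eq0 w1 oner_eq0.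
  case: eqVneq => [<-|ij]; last by rewrite NE /S /signature; ring.
  by rewrite frame_gram_diag // mulr1 divff ?mulr1.
rewrite !mxE mulVKf ?sqrt5_neq0 //.
have Na := No _ (neq_base _ o _ _ _ _ _ U).
have Nb : N o b = 1 by apply: No; apply: (neq_base _ o b a c d e); reorder U.
have Nc : N o c = 1 by apply: No; apply: (neq_base _ o c a b d e); reorder U.
have Nd : N o d = 1 by apply: No; apply: (neq_base _ o d a b c e); reorder U.
have Ne : N o e = 1 by apply: No; apply: (neq_base _ o e a b c d); reorder U.
rewrite /f; case: i => [[|[|[|[|[|[|//]]]]]] ?];
  case: j => [[|[|[|[|[|[|//]]]]]] ?] //=.
(* What remains lies below the diagonal and is conjugate to a known entry. *)
all: by rewrite Nconj ?(Na, Nb, Nc, Nd, Ne, ea, eb, ec, ed, ab, cd, ad, bc, bd)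
  ?rmorphN ?rmorph1.
Qed.

End Equivalence.

Local Open Scope complex_scope.

Theorem proposition4p1 (R : realType) (G : 'M[R[i]]_6)
    (hG : is_frame_gram 3 G) :
  exists a : R[i], `|a| = 1 /\ gram_equiv G (G61 a).
Proof. by case: hG => phi phi_frame ->; apply: gram_equiv_G61. Qed.
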